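(* Let $n$ be a positive integer and $\lambda\in\mathbb{R}$. Write $g_1=\gamma_1(\lambda/n)$, $g_2=\gamma_2(\lambda/n)$ and $D=\Delta(\lambda/n)$. Then $$\begin{aligned} d_{n}(\lambda) ={}& \frac{g_1^{n+1} - g_2^{n+1}}{\sqrt{D}} - \frac{\alpha^2\left[g_1^{n} - g_2^{n}\right]}{\sqrt{D}} + \frac{\lambda\left[g_1^{n+1} + g_2^{n+1}\right]}{n \,D} - \frac{(n-1) \alpha^2 \, \lambda\left[g_1^{n} + g_2^{n}\right]}{n^2 \,D} \\ & + \frac{2 (n-1) \alpha \, \lambda\left[g_1^{n+1} + g_2^{n+1}\right]}{n \,D \left( n (1-\alpha)^2 - \lambda \right)} - \frac{2 (n-2) \alpha^3 \, \lambda\left[g_1^{n} + g_2^{n}\right]}{n \,D \left( n (1-\alpha)^2 - \lambda \right)} \\ & - \frac{2 (n+1) \alpha^2 \, \lambda\left[g_1^{n} + g_2^{n}\right]}{n \,D \left( n (1-\alpha)^2 - \lambda \right)} + \frac{2 \alpha^4 \, \lambda\left[g_1^{n-1} + g_2^{n-1}\right]}{D \left( n (1-\alpha)^2 - \lambda \right)} \\ & + \frac{2 \, \alpha^{n+1} (1- \alpha) \, \lambda\left[g_1 + g_2\right]}{n \,D \left( n (1-\alpha)^2 - \lambda \right)} + \frac{4 \, \alpha^{n+2} (1- \alpha) \, \lambda}{n \,D \left( n (1-\alpha)^2 - \lambda \right)}, \end{aligned}$$ where at the two points $\lambda=n(1-\alpha)^2$ and $\lambda=n(1+\alpha)^2$,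 at which $D=0$, the right-hand side is understood as its limit (extension by continuity in $\lambda$).
   Context: Let $\alpha\in\mathbb{R}$ with $|\alpha|<1$ (with the convention $x^0=1$, including $x=0$). $K_n$ is the $n\times n$ symmetric matrix with entries $$(K_n)_{jk}=\frac1n\,\frac{\alpha^{|k-j|}-\alpha^{k+j}}{1-\alpha^2}-\frac1{n^2}\,\frac{(1-\alpha^k)(1-\alpha^j)}{(1-\alpha)^2},\qquad 1\le j,k\le n,$$ and $d_n(\lambda)=\det(I_n-\lambda K_n)$, where $I_n$ is the identity matrix (the ''alternative characteristic polynomial'' of $K_n$). For real $\lambda$, $$\Delta(\lambda)=(1-\lambda+\alpha^2)^2-4\alpha^2,\quad \gamma_1(\lambda)=\frac{(1-\lambda+\alpha^2)+\sqrt{\Delta(\lambda)}}{2},\quad \gamma_2(\lambda)=\frac{(1-\lambda+\alpha^2)-\sqrt{\Delta(\lambda)}}{2},$$ where, if $\Delta(\lambda)<0$, $\sqrt{\Delta(\lambda)}$ denotes a complex square root, the same one in all occurrences. *)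

(* Defs.v *)
From mathcomp Require Import all_boot all_order all_algebra.
From mathcomp Require Import complex.
From mathcomp Require Import all_classical all_reals all_analysis.

Set Implicit Arguments.
Unset Strict Implicit.
Unset Printing Implicit Defensive.

Import Order.TTheory GRing.Theory Num.Theory.
Import numFieldNormedType.Exports.
Local Open Scope ring_scope.
Local Open Scope complex_scope.
Local Open Scope classical_set_scope.

(* [is_sqrt s]: s is an admissible reading of the square root of a real number:
   the usual nonnegative root on [0, +oo[, and an arbitrary one of the two
   complex roots at each negative real. *)
Definition is_sqrt (R : realType) (s : R -> R[i]) : Prop :=
  (forall x : R, 0 <= x -> s x = (Num.sqrt x)%:C) /\
  (forall x : R, x < 0 -> s x ^+ 2 = x%:C).

(* The ordinals j, k : 'I_n stand for the indices j.+1, k.+1 in {1, ..., n};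
   [`|_ - _|%N] is the distance between naturals, not a truncated difference. *)
Definition K_mx (R : realType) (alpha : R) (n : nat) : 'M[R]_n :=
  \matrix_(j < n, k < n)
    (n%:R^-1 * ((alpha ^+ `|k.+1 - j.+1|%N - alpha ^+ (k.+1 + j.+1))
                / (1 - alpha ^+ 2))
     - (n%:R ^+ 2)^-1 * ((1 - alpha ^+ k.+1) * (1 - alpha ^+ j.+1)
                         / (1 - alpha) ^+ 2)).

Definition alt_charpoly (R : realType) (alpha : R) (n : nat) (lambda : R) : R :=
  \det (1%:M - lambda *: K_mx alpha n).

Definition Delta (R : realType) (alpha lambda : R) : R :=
  (1 - lambda + alpha ^+ 2) ^+ 2 - 4 * alpha ^+ 2.

Definition gamma1 (R : realType) (s : R -> R[i]) (alpha lambda : R) : R[i] :=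
  ((1 - lambda + alpha ^+ 2)%:C + s (Delta alpha lambda)) / 2.

Definition gamma2 (R : realType) (s : R -> R[i]) (alpha lambda : R) : R[i] :=
  ((1 - lambda + alpha ^+ 2)%:C - s (Delta alpha lambda)) / 2.

(* At the zeros of [Delta alpha (lambda / n)] the value is meaningless, since
   division by 0 returns 0. *)
Definition dn_formula (R : realType) (s : R -> R[i]) (alpha : R) (n : nat)
    (lambda : R) : R[i] :=
  let g1 := gamma1 s alpha (lambda / n%:R) in
  let g2 := gamma2 s alpha (lambda / n%:R) in
  let rD := s (Delta alpha (lambda / n%:R)) in
  let D := (Delta alpha (lambda / n%:R))%:C in
  let a := alpha%:C in
  let l := lambda%:C in
  let N : R[i] := n%:R in
  let E := N * (1 - a) ^+ 2 - l in
  (g1 ^+ n.+1 - g2 ^+ n.+1) / rD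
  - a ^+ 2 * (g1 ^+ n - g2 ^+ n) / rD
  + l * (g1 ^+ n.+1 + g2 ^+ n.+1) / (N * D)
  - (N - 1) * a ^+ 2 * l * (g1 ^+ n + g2 ^+ n) / (N ^+ 2 * D)
  + 2 * (N - 1) * a * l * (g1 ^+ n.+1 + g2 ^+ n.+1) / (N * D * E)
  - 2 * (N - 2) * a ^+ 3 * l * (g1 ^+ n + g2 ^+ n) / (N * D * E)
  - 2 * (N + 1) * a ^+ 2 * l * (g1 ^+ n + g2 ^+ n) / (N * D * E)
  + 2 * a ^+ 4 * l * (g1 ^+ n.-1 + g2 ^+ n.-1) / (D * E)
  + 2 * a ^+ n.+1 * (1 - a) * l * (g1 + g2) / (N * D * E)
  + 4 * a ^+ n.+2 * (1 - a) * l / (N * D * E).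

(* Main.v *)
Require Import Defs.
From mathcomp Require Import all_boot all_order all_algebra.
From mathcomp Require Import complex.
From mathcomp Require Import all_classical all_reals all_analysis.
From mathcomp Require Import ring zify.

Import Order.TTheory GRing.Theory Num.Theory.
Import numFieldNormedType.Exports.
Local Open Scope ring_scope.
Local Open Scope complex_scope.
Local Open Scope classical_set_scope.

(** Up to scaling, [K_mx] is the covariance matrix of a first-order autoregressive
sequence started at 0 and driven by white noise from which its empirical mean
is subtracted; undoing the autoregression leaves the matrix
[1 / n - J / n^2], with [J] the all-ones matrix.  Let [B] be the lower bidiagonal
matrix with 1 on the diagonal and [- alpha] below it, and put [m = lambda / n].
Since [det B = 1], the determinant [d_n(lambda)] is that of
[B (1 - lambda K) B^T], which is [T + (m / n) J]: here [T] is tridiagonal and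
Toeplitz except in its first corner, with diagonal [x = 1 + alpha^2 - m],
corner [x - alpha^2] and off-diagonal [- alpha]
([one_sub_K_mx_congr]).

The matrix [T] encodes the recurrence [U_(k+2) = x U_(k+1) - alpha^2 U_k],
whose solution starting with 0, 1 is the Lucas sequence [U_k(x, alpha^2)].  A
solution of the recurrence satisfying the left boundary condition yields a
triangular factorization of [T], hence
[det T = t_n = U_(n+1) - alpha^2 U_n].  Adding suitable multiples of the two
solutions that satisfy one boundary condition each to a constant vector gives
an explicit [w] with [T w = (x - 2 alpha) t_n (1, ..., 1)], and the rank-one
update formula turns [w] into [det (T + c J)].  The entries of [w] sum to
geometric convolutions of [U], which have closed forms
([convol_lucasU], [convol_tridiag_det]).

These steps divide by the [t_k] and by [x - 2 alpha].  They are carried out with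
an indeterminate [x], where all of these are nonzero, and then specialized
([det_tridiag_mxD_const]); the resulting identity keeps only the factor
[(x - 2 alpha)^2].

Finally [gamma_1 + gamma_2 = x] and [gamma_1 gamma_2 = alpha^2], whatever
square root is chosen, so Binet's formula rewrites every power of [gamma_1] and
[gamma_2] in the stated formula through [U_n] and [U_(n+1)]; what is left is an
identity of rational functions ([closed_form_lucasU]).  Here
[Delta = (x - 2 alpha) (x + 2 alpha)], so its zeros are exactly the two
exceptional values of [lambda].  At these, the formula agrees with the
determinant on a punctured neighbourhood, and the determinant is continuous
in [lambda]. *)

(** * Lucas sequences *)
Fixpoint lucasU {R : comNzRingType} (P Q : R) (n : nat) : R :=
  match n with
  | 0%N => 0
  | m.+1 => match m with
            | 0%N => 1
            | k.+1 => P * lucasU P Q m - Q * lucasU P Q k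
            end
  end.
Arguments lucasU : simpl nomatch.

Lemma lucasUSS {R : comNzRingType} (P Q : R) (n : nat) :
  lucasU P Q n.+2 = P * lucasU P Q n.+1 - Q * lucasU P Q n.
Proof. by []. Qed.

Lemma map_lucasU {R S : comNzRingType} (f : {rmorphism R -> S}) (P Q : R)
    (n : nat) : f (lucasU P Q n) = lucasU (f P) (f Q) n.
Proof.
elim/ltn_ind: n => -[|[|n]] IHn; rewrite ?rmorph0 ?rmorph1 //.
by rewrite !lucasUSS rmorphB !rmorphM !IHn.
Qed.

Lemma size_lucasU_polyX {R : idomainType} (q : R) (n : nat) :
  size (lucasU 'X (q%:P) n.+1) = n.+1.
Proof.
elim/ltn_ind: n => -[|[|n]] IHn; first by rewrite size_poly1.
  by rewrite /= mulr0 subr0 mulr1 size_polyX.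
rewrite lucasUSS.
have U0 : lucasU 'X q%:P n.+2 != 0 by rewrite -size_poly_gt0 IHn.
have sX : size ('X * lucasU 'X q%:P n.+2) = n.+3.
  by rewrite mulrC size_mulX // IHn.
rewrite size_polyDl sX // size_polyN.
apply: leq_ltn_trans (size_polyMleq _ _) _.
by rewrite IHn // size_polyC; case: (q != 0) => /=; lia.
Qed.

Lemma lucasU_binet {R : comNzRingType} (g1 g2 : R) (n : nat) :
  (g1 - g2) * lucasU (g1 + g2) (g1 * g2) n = g1 ^+ n - g2 ^+ n.
Proof.
elim/ltn_ind: n => -[|[|n]] IHn; [by rewrite /=; ring | by rewrite /=; ring |].
rewrite lucasUSS mulrBr mulrCA IHn // [(g1 - g2) * _]mulrCA IHn //.
by rewrite !exprS; ring.
Qed.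

(** The left-hand side is the companion Lucas sequence [V_n]. *)
Lemma lucasU_companion {R : comNzRingType} (g1 g2 : R) (n : nat) :
  g1 ^+ n + g2 ^+ n = 2 * lucasU (g1 + g2) (g1 * g2) n.+1
    - (g1 + g2) * lucasU (g1 + g2) (g1 * g2) n.
Proof.
elim/ltn_ind: n => -[|[|n]] IHn; [by rewrite /=; ring | by rewrite /=; ring |].
have -> : g1 ^+ n.+2 + g2 ^+ n.+2 = (g1 + g2) * (g1 ^+ n.+1 + g2 ^+ n.+1)
    - g1 * g2 * (g1 ^+ n + g2 ^+ n) by rewrite !exprS; ring.
by rewrite !IHn // !lucasUSS; ring.
Qed.

(** * A tridiagonal matrix with one modified corner *)
Definition tridiag_mx {R : comNzRingType} (a x : R) (n : nat) : 'M[R]_n :=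
  \matrix_(i < n, j < n)
    (x *+ (i == j :> nat) - a *+ (i == j.+1 :> nat) - a *+ (j == i.+1 :> nat)
     - a ^+ 2 *+ ((i == 0 :> nat)%N && (j == 0 :> nat)%N)).

(** As [det_tridiag_mx_regular] shows, these are the leading principal minors of
[tridiag_mx]; with an indeterminate [x] they are monic, hence nonzero. *)
Definition tridiag_det {R : comNzRingType} (a x : R) (n : nat) : R :=
  lucasU x (a ^+ 2) n.+1 - a ^+ 2 * lucasU x (a ^+ 2) n.

Lemma tridiag_det0 {R : comNzRingType} (a x : R) : tridiag_det a x 0 = 1.
Proof. by rewrite /tridiag_det /= mulr0 subr0. Qed.

Lemma tridiag_det1 {R : comNzRingType} (a x : R) :
  tridiag_det a x 1 = x - a ^+ 2.
Proof. by rewrite /tridiag_det /=; ring. Qed.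

Lemma tridiag_detSS {R : comNzRingType} (a x : R) (n : nat) :
  tridiag_det a x n.+2
    = x * tridiag_det a x n.+1 - a ^+ 2 * tridiag_det a x n.
Proof. by rewrite /tridiag_det !lucasUSS; ring. Qed.

Lemma sum_delta {R : comNzRingType} (n k : nat) (c : R) (f : nat -> R) :
  \sum_(j < n) c *+ (k == j :> nat) * f j = (c * f k) *+ (k < n)%N.
Proof.
case: ltnP => kn; last first.
  by rewrite big1 // => j _; rewrite gtn_eqF ?mul0r // (leq_trans (ltn_ord j)).
rewrite (bigD1 (Ordinal kn)) //= eqxx mulr1n big1 ?addr0 // => j nj.
by case: eqP => [kj|]; [move/eqP: nj; case; exact: val_inj | rewrite mul0r].
Qed.

(** The vector [h 1, ..., h n] is extended by [h 0] and [h n.+1] so that the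
two truncated rows follow the same three-term pattern as the others.  The
corner [x - a ^+ 2] becomes the left boundary condition [h 0 = a * h 1]. *)
Lemma tridiag_mx_sum {R : comNzRingType} (a x : R) (n : nat) (h : nat -> R)
    (i : 'I_n) :
  h 0%N = a * h 1%N -> h n.+1 = 0 ->
  \sum_(j < n) tridiag_mx a x n i j * h j.+1
    = x * h i.+1 - a * h i - a * h i.+2.
Proof.
move=> h0 hn.
under eq_bigr => j _ do rewrite mxE !mulrBl.
rewrite !sumrB (sum_delta n i x (fun j => h j.+1)) ltn_ord mulr1n.
have -> : \sum_(j < n) a *+ (j == i.+1 :> nat)%N * h j.+1 = a * h i.+2.
  under eq_bigr => j _ do rewrite eq_sym.
  rewrite (sum_delta n i.+1 a (fun j => h j.+1)).
  case: ltnP => // ni; have -> : i.+2 = n.+1 by have := ltn_ord i; lia.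
  by rewrite hn mulr0.
have n0 : (0 < n)%N by apply: leq_ltn_trans (ltn_ord i).
case: i => [[|i] /= ltin].
  rewrite [X in _ - X - _ - _]big1 => [|j _]; last by rewrite mul0r.
  under [X in _ - X]eq_bigr => j _ do rewrite eq_sym.
  by rewrite (sum_delta n 0 (a ^+ 2) (fun j => h j.+1)) n0 mulr1n h0; ring.
rewrite [X in _ - _ - _ - X]big1 => [|j _]; last by rewrite mul0r.
rewrite (sum_delta n i a (fun j => h j.+1)) (ltnW ltin) mulr1n.
by ring.
Qed.

(** The columns of [W] are truncations of the solution of the recurrence that
satisfies the left boundary condition.  So [T W] vanishes above its diagonal,
where truncation has no effect; its diagonal carries [t_1, ..., t_n] and that of
the triangular matrix [W] carries [t_0, ..., t_(n-1)].  The quotient of the two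
determinants telescopes. *)
Lemma det_tridiag_mx_regular {R : idomainType} (a x : R) (n : nat) :
  (forall k, tridiag_det a x k != 0) ->
  \det (tridiag_mx a x n) = tridiag_det a x n.
Proof.
move=> reg.
(* The value at index 0 is the one forced by the left boundary condition. *)
pose h k j := match j with
  | 0%N => a ^+ k.+1
  | i.+1 => (a ^+ (k - i) * tridiag_det a x i) *+ (i <= k)%N
  end.
pose W : 'M[R]_n := \matrix_(i < n, k < n) h k i.+1.
have h0 k : h k 0%N = a * h k 1%N.
  by rewrite /h /= subn0 tridiag_det0 mulr1 exprS.
have TWE (i k : 'I_n) : (tridiag_mx a x n *m W) i k =
    x * h k i.+1 - a * h k i - a * h k i.+2.
  have hn : h k n.+1 = 0 by rewrite /h leqNgt ltn_ord.
  rewrite mxE -(tridiag_mx_sum a x n (h k) i (h0 k) hn).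
  by apply: eq_bigr => j _; rewrite [W _ _]mxE.
have trigTW : is_trig_mx (tridiag_mx a x n *m W).
  apply/is_trig_mxP => i k ik; rewrite TWE.
  case: i ik => [[|i] /= ltin] ik.
    rewrite /h ik /= subn0 tridiag_det0 tridiag_det1.
    have [m ->] : exists m, nat_of_ord k = m.+1 by exists k.-1; lia.
    by rewrite subSS subn0 !exprS; ring.
  rewrite /h ik (ltnW ik) (ltnW (ltnW ik)) !mulr1n tridiag_detSS.
  have -> : (k - i = (k - i.+2).+2)%N by lia.
  have -> : (k - i.+1 = (k - i.+2).+1)%N by lia.
  by rewrite !exprS; ring.
have diagTW i : (tridiag_mx a x n *m W) i i = tridiag_det a x i.+1.
  rewrite TWE; case: i => [[|i] /= ltin].
    by rewrite /h /= tridiag_det0 tridiag_det1; ring.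
  rewrite /h leqnn leqnSn ltnn !mulr1n subnn subSnn tridiag_detSS.
  by rewrite mulr0n; ring.
have detW : \det W = \prod_(i < n) tridiag_det a x i.
  rewrite -det_tr det_trig.
    by apply: eq_bigr => i _; rewrite !mxE /h subnn leqnn expr0 mul1r.
  by apply/is_trig_mxP => i k ik; rewrite !mxE /h leqNgt ik.
have := det_trig trigTW.
rewrite det_mulmx detW (eq_bigr _ (fun i _ => diagTW i)) => E.
have : \prod_(i < n) tridiag_det a x i.+1 =
   tridiag_det a x n * \prod_(i < n) tridiag_det a x i.
  rewrite mulrC -(big_ord_recr n (fun i : 'I_n.+1 => tridiag_det a x i)).
  by rewrite big_ord_recl /= tridiag_det0 mul1r.
rewrite -E; apply: mulIf.
by apply/prodf_neq0 => i _.
Qed.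

(** * Rank-one updates of determinants *)
(** Sylvester's identity, with a scalar [q] that need not be invertible: the
block matrix [M] is triangularized in two ways. *)
Lemma det_scalarD_rank1 {R : idomainType} (n : nat) (q : R)
    (u : 'cV[R]_n) (v : 'rV[R]_n) : q != 0 ->
  \det (q%:M + u *m v) * q = q ^+ n * (q + (v *m u) 0 0).
Proof.
move=> q0.
pose M := block_mx q%:M (- u) v 1%:M.
have d1 : \det M = \det (q%:M + u *m v).
  have : M *m block_mx 1%:M 0 (- v) 1%:M = block_mx (q%:M + u *m v) (- u) 0 1%:M.
    rewrite mulmx_block !mulmx1 !mulmx0 !mul1mx !add0r.
    by rewrite mulNmx mulmxN opprK subrr.
  move/(congr1 determinant); rewrite det_mulmx det_lblock det_ublock !det1.
  by rewrite !mulr1.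
have : M *m block_mx 1%:M u 0 q%:M = block_mx q%:M 0 v (q%:M + v *m u).
  rewrite mulmx_block !mulmx1 !mulmx0 !addr0 !mul1mx mulNmx.
  by rewrite mul_scalar_mx mul_mx_scalar subrr addrC.
move/(congr1 determinant); rewrite det_mulmx d1 det_lblock det_ublock.
rewrite !det_scalar expr1n expr1 mul1r => ->.
by rewrite det_mx11 !mxE eqxx mulr1n.
Qed.

(** The matrix determinant lemma, with [T^-1 u] replaced by a solution [w] of
[T w = q u], so that neither [T] nor [q] has to be inverted. *)
Lemma det_rank1_update {R : idomainType} (n : nat) (T : 'M[R]_n)
    (u w : 'cV[R]_n) (v : 'rV[R]_n) (q : R) : q != 0 ->
  T *m w = q *: u ->
  q * \det (T + u *m v) = \det T * (q + (v *m w) 0 0).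
Proof.
move=> q0 Tw.
have E : T *m (q%:M + w *m v) = q *: (T + u *m v).
  by rewrite mulmxDr mul_mx_scalar mulmxA Tw -scalemxAl scalerDr.
move/(congr1 determinant): E; rewrite det_mulmx detZ => E.
have := det_scalarD_rank1 n q w v q0.
move/(congr1 (fun z => \det T * z)); rewrite mulrA E => E2.
have qn : q ^+ n != 0 by rewrite expf_neq0.
by apply: (mulfI qn); rewrite [RHS]mulrCA -E2; ring.
Qed.

(** * Adding a constant matrix to the tridiagonal one *)
Lemma convol_powS {R : comNzRingType} (a : R) (f : nat -> R) (n : nat) :
  \sum_(i < n.+1) a ^+ (n.+1 - i) * f i
    = a * (\sum_(i < n) a ^+ (n - i) * f i) + a * f n.
Proof.
rewrite big_ord_recr /= subSnn expr1 mulr_sumr; congr (_ + _).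
by apply: eq_bigr => i _; rewrite subSn ?(ltnW (ltn_ord i)) // exprS mulrA.
Qed.

(** The generating series of [U] is [X / (1 - x X + a ^+ 2 X ^ 2)], whose
denominator has value [(2 a - x) / a] at [X = a^-1]: this is where the factor
[x - 2 * a] comes from. *)
Lemma convol_lucasU {R : comNzRingType} (a x : R) (n : nat) :
  (x - 2 * a) * (\sum_(i < n) a ^+ (n - i) * lucasU x (a ^+ 2) i.+1)
    = a * lucasU x (a ^+ 2) n.+1 - a ^+ 2 * lucasU x (a ^+ 2) n - a ^+ n.+1.
Proof.
elim: n => [|n IHn]; first by rewrite big_ord0 /=; ring.
rewrite (convol_powS a (fun i => lucasU x (a ^+ 2) i.+1)) mulrDr mulrCA IHn.
by rewrite lucasUSS !exprS; ring.
Qed.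

Lemma convol_tridiag_det {R : comNzRingType} (a x : R) (n : nat) :
  (x - 2 * a) * (\sum_(i < n) a ^+ (n - i) * tridiag_det a x i)
    = a * (1 - a) * lucasU x (a ^+ 2) n.+1
      + a ^+ 2 * (x - 1 - a) * lucasU x (a ^+ 2) n - a ^+ n.+1 * (1 - a).
Proof.
elim: n => [|n IHn]; first by rewrite big_ord0 /=; ring.
rewrite convol_powS mulrDr mulrCA IHn /tridiag_det.
by rewrite lucasUSS !exprS; ring.
Qed.

(** The vector [h] below is the constant [t] minus a solution of the recurrence
satisfying the left boundary condition and minus a multiple of one satisfying
the right one.  Their coefficients are chosen so that [h] satisfies both conditions;
the three-term pattern of [tridiag_mx_sum] kills the two solutions and
multiplies the constant by [x - 2 * a]. *)
Lemma det_tridiag_mxD_const_regular {R : idomainType} (a x c : R) (n : nat) :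
  (forall k, tridiag_det a x k != 0) -> x - 2 * a != 0 ->
  (x - 2 * a) ^+ 2 * \det (tridiag_mx a x n + const_mx c)
    = (x - 2 * a) ^+ 2 * tridiag_det a x n
      + c * (n%:R * (x - 2 * a) * tridiag_det a x n
             - (a * (1 - a) * lucasU x (a ^+ 2) n.+1
                + a ^+ 2 * (x - 1 - a) * lucasU x (a ^+ 2) n
                - a ^+ n.+1 * (1 - a))
             - (1 - a) * (a * lucasU x (a ^+ 2) n.+1
                          - a ^+ 2 * lucasU x (a ^+ 2) n - a ^+ n.+1)).
Proof.
move=> reg k0; set t := tridiag_det a x n.
pose g j := match j with
  | 0%N => a ^+ n.+1
  | i.+1 => a ^+ (n - i) * tridiag_det a x i
  end.
pose h j := t - g j - (1 - a) * (a ^+ j * lucasU x (a ^+ 2) (n.+1 - j)).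
have h0 : h 0%N = a * h 1%N.
  by rewrite /h /g /t !subn0 subn1 tridiag_det0 /tridiag_det !exprS; ring.
have hn : h n.+1 = 0 by rewrite /h /g !subnn /= expr0 /t; ring.
pose w : 'cV[R]_n := \col_(i < n) h i.+1.
pose u : 'cV[R]_n := const_mx 1.
pose v : 'rV[R]_n := const_mx c.
have Tw : tridiag_mx a x n *m w = ((x - 2 * a) * t) *: u.
  apply/matrixP => i j; rewrite !mxE mulr1.
  under eq_bigr => k _ do rewrite [w _ _]mxE.
  rewrite (tridiag_mx_sum a x n h i h0 hn).
  case: i => [[|i] /= ltin]; rewrite /h /g.
    have [m ->] : exists m, n = m.+1 by exists n.-1; lia.
    rewrite !subSS !subn0 tridiag_det0 tridiag_det1 lucasUSS !exprS /=.
    by ring.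
  have [m ->] : exists m, n = (i.+2 + m)%N by exists (n - i.+2)%N; lia.
  have -> : ((i.+2 + m) - i.+2 = m)%N by lia.
  have -> : ((i.+2 + m) - i.+1 = m.+1)%N by lia.
  have -> : ((i.+2 + m) - i = m.+2)%N by lia.
  have -> : ((i.+2 + m).+1 - i.+3 = m)%N by lia.
  have -> : ((i.+2 + m).+1 - i.+2 = m.+1)%N by lia.
  have -> : ((i.+2 + m).+1 - i.+1 = m.+2)%N by lia.
  by rewrite tridiag_detSS lucasUSS !exprS; ring.
have q0 : (x - 2 * a) * t != 0 by rewrite mulf_neq0 ?reg.
have := det_rank1_update n (tridiag_mx a x n) u w v _ q0 Tw.
rewrite det_tridiag_mx_regular // -/t.
have -> : u *m v = const_mx c.
  by apply/matrixP => i j; rewrite !mxE big_ord1 !mxE mul1r.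
have -> : (v *m w) 0 0 = c * \sum_(i < n) h i.+1.
  by rewrite mxE mulr_sumr; apply: eq_bigr => i _; rewrite !mxE.
move=> E; have {}E : (x - 2 * a) * \det (tridiag_mx a x n + const_mx c)
    = (x - 2 * a) * t + c * \sum_(i < n) h i.+1.
  by apply: (mulfI (reg n)); rewrite -E -/t; ring.
have Sh : \sum_(i < n) h i.+1
    = n%:R * t - \sum_(i < n) a ^+ (n - i) * tridiag_det a x i
      - (1 - a) * \sum_(i < n) a ^+ (n - i) * lucasU x (a ^+ 2) i.+1.
  rewrite /h sumrB sumrB sumr_const card_ord mulr_natl; congr (_ - _).
  rewrite -mulr_sumr; congr (_ * _).
  rewrite (reindex_inj rev_ord_inj) /=; apply: eq_bigr => i _.
  have lin := ltn_ord i.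
  by congr (a ^+ _ * lucasU x (a ^+ 2) _); lia.
rewrite expr2 -mulrA E Sh -convol_tridiag_det -convol_lucasU.
by ring.
Qed.

(** Specialization of an indeterminate ['X] to [x], which removes the regularity
conditions: over the polynomials every [t_k] is monic of degree [k]. *)
Lemma det_tridiag_mxD_const {R : idomainType} (a x c : R) (n : nat) :
  (x - 2 * a) ^+ 2 * \det (tridiag_mx a x n + const_mx c)
    = (x - 2 * a) ^+ 2 * tridiag_det a x n
      + c * (n%:R * (x - 2 * a) * tridiag_det a x n
             - (a * (1 - a) * lucasU x (a ^+ 2) n.+1
                + a ^+ 2 * (x - 1 - a) * lucasU x (a ^+ 2) n
                - a ^+ n.+1 * (1 - a))
             - (1 - a) * (a * lucasU x (a ^+ 2) n.+1
                          - a ^+ 2 * lucasU x (a ^+ 2) n - a ^+ n.+1)).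
Proof.
have reg k : tridiag_det a%:P 'X k != 0.
  rewrite /tridiag_det -polyC_exp -size_poly_gt0.
  case: k => [|k]; first by rewrite mulr0 subr0 size_poly1.
  rewrite size_polyDl ?size_lucasU_polyX // size_polyN.
  apply: leq_ltn_trans (size_polyMleq _ _) _.
  by rewrite size_lucasU_polyX size_polyC; case: (_ != 0) => /=; lia.
have k0 : 'X - 2 * a%:P != 0 :> {poly R}.
  by rewrite -polyC_natr -polyCM polyXsubC_eq0.
have := det_tridiag_mxD_const_regular a%:P 'X c%:P n reg k0.
have ev p q : p = q -> horner_eval x p = horner_eval x q by move=> ->.
move/ev; rewrite /tridiag_det.
rewrite !(rmorphXn, rmorphN, rmorphM, rmorphD, rmorph1, rmorph_nat, map_lucasU) /=.
rewrite -det_map_mx.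
rewrite /horner_eval hornerX !hornerC.
suff -> : map_mx (horner_eval x) (tridiag_mx a%:P 'X n + const_mx c%:P)
    = tridiag_mx a x n + const_mx c by [].
apply/matrixP => i j; rewrite !mxE rmorphD !rmorphB !rmorphMn /=.
by rewrite rmorphXn /= /horner_eval hornerX !hornerC.
Qed.

(** * Reduction of K_n to the tridiagonal matrix *)
Definition bidiag_mx {R : comNzRingType} (a : R) (n : nat) : 'M[R]_n :=
  \matrix_(i < n, j < n) (1 *+ (i == j :> nat) - a *+ (i == j.+1 :> nat)).

Lemma det_bidiag_mx {R : comNzRingType} (a : R) (n : nat) :
  \det (bidiag_mx a n) = 1.
Proof.
rewrite det_trig.
  by rewrite big1 // => i _; rewrite mxE eqxx ltn_eqF // subr0.
apply/is_trig_mxP => i j ij.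
by rewrite mxE !ltn_eqF ?subr0 // (ltn_trans ij).
Qed.

Lemma bidiag_mx_sum {R : comNzRingType} (a : R) (n : nat) (h : nat -> R)
    (i : 'I_n) :
  h 0%N = 0 -> \sum_(j < n) bidiag_mx a n i j * h j.+1 = h i.+1 - a * h i.
Proof.
move=> h0; under eq_bigr => j _ do rewrite mxE mulrBl.
rewrite sumrB (sum_delta n i 1 (fun j => h j.+1)) ltn_ord mulr1n mul1r.
congr (_ - _); case: i => [[|i] /= ltin].
  by rewrite h0 mulr0 big1 // => j _; rewrite mul0r.
by rewrite (sum_delta n i a (fun j => h j.+1)) (ltnW ltin).
Qed.

(** Both products act by differencing [f]; its vanishing at index 0 makes the
first row and column follow the general pattern. *)
Lemma bidiag_mx_congr {R : comNzRingType} (a : R) (n : nat)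
    (f : nat -> nat -> R) :
  (forall k, f 0%N k = 0) -> (forall j, f j 0%N = 0) ->
  bidiag_mx a n *m \matrix_(i < n, j < n) f i.+1 j.+1 *m (bidiag_mx a n)^T
    = \matrix_(i < n, j < n)
        (f i.+1 j.+1 - a * f i j.+1 - a * (f i.+1 j - a * f i j)).
Proof.
move=> f0l f0r; apply/matrixP => i j; rewrite [RHS]mxE mxE.
pose h k := f i.+1 k - a * f i k.
rewrite -(bidiag_mx_sum a n h j); last by rewrite /h !f0r mulr0 subr0.
apply: eq_bigr => k _; rewrite [_^T _ _]mxE mulrC; congr (_ * _).
rewrite mxE -[RHS](bidiag_mx_sum a n (fun l => f l k.+1) i) //.
by apply: eq_bigr => l _; congr (_ * _); rewrite mxE.
Qed.

(** The entries of [K_mx] are given by a formula that vanishes when an index is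
0, so [bidiag_mx_congr] applies.  Differencing kills
[a ^+ `|k - j| - a ^+ (k + j)] off the diagonal and leaves [1 - a ^+ 2] on it,
and it turns [1 - a ^+ k] into the constant [1 - a]; so [K_mx] becomes
[1 / n - J / n ^ 2]. *)
Lemma one_sub_K_mx_congr {R : realType} (a l : R) (n : nat) :
  1 - a ^+ 2 != 0 -> 1 - a != 0 -> (0 < n)%N ->
  bidiag_mx a n *m (1%:M - l *: K_mx a n) *m (bidiag_mx a n)^T
    = tridiag_mx a (1 + a ^+ 2 - l / n%:R) n + const_mx (l / n%:R ^+ 2).
Proof.
move=> a2 a1 n0; have N0 : n%:R != 0 :> R by rewrite pnatr_eq0 -lt0n.
pose K (j k : nat) : R := n%:R^-1 * ((a ^+ `|k - j|%N - a ^+ (k + j)) / (1 - a ^+ 2))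
     - (n%:R ^+ 2)^-1 * ((1 - a ^+ k) * (1 - a ^+ j) / (1 - a) ^+ 2).
pose f (j k : nat) : R := 1 *+ ((0 < j)%N && (j == k)) - l * K j k.
have f0l k : f 0%N k = 0.
  by rewrite /f /K distn0 addn0 !expr0 !subrr /= mulr0n; ring.
have f0r j : f j 0%N = 0.
  rewrite /f /K dist0n add0n !expr0 !subrr.
  have -> : (0 < j)%N && (j == 0%N) = false by case: j.
  by rewrite mulr0n; ring.
have -> : 1%:M - l *: K_mx a n = \matrix_(i < n, j < n) f i.+1 j.+1.
  by apply/matrixP => i j; rewrite !mxE /f /K eqSS.
rewrite bidiag_mx_congr //; apply/matrixP => i j; rewrite !mxE /f /K !eqSS /=.
move: (nat_of_ord i) (nat_of_ord j) => {i j} i j.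
case: (ltngtP i j) => [ij|ji|->].
- have [d ->] : exists d, j = (i + d.+1)%N by exists (j - i.+1)%N; lia.
  have -> : (`|(i + d.+1).+1 - i.+1| = d.+1)%N by lia.
  have -> : (`|(i + d.+1).+1 - i| = d.+2)%N by lia.
  have -> : (`|(i + d.+1) - i.+1| = d)%N by lia.
  have -> : (`|(i + d.+1) - i| = d.+1)%N by lia.
  have -> : (i == (i + d.+1).+1) = false by apply/eqP; lia.
  have -> : ((i == 0%N) && (i + d.+1 == 0)%N) = false by rewrite addnS andbF.
  rewrite andbF /= [i.+1 == _]eq_sym !mulr0n !(exprS, exprD, addSn, addnS).
  by case: (_ == _); rewrite /= ?mulr1n ?mulr0n; field; rewrite N0 a2 a1.
- have [d ->] : exists d, i = (j + d.+1)%N by exists (i - j.+1)%N; lia.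
  have -> : (`|j.+1 - (j + d.+1).+1| = d.+1)%N by lia.
  have -> : (`|j.+1 - (j + d.+1)| = d)%N by lia.
  have -> : (`|j - (j + d.+1).+1| = d.+2)%N by lia.
  have -> : (`|j - (j + d.+1)| = d.+1)%N by lia.
  have -> : (j == (j + d.+1).+1) = false by apply/eqP; lia.
  have -> : ((j + d.+1).+1 == j) = false by apply/eqP; lia.
  have -> : ((j + d.+1 == 0)%N && (j == 0%N)) = false by rewrite addnS.
  have -> : (0 < j + d.+1)%N by lia.
  rewrite /= !mulr0n !(exprS, exprD, addSn, addnS).
  by case: (_ == _); rewrite /= ?mulr1n ?mulr0n; field; rewrite N0 a2 a1.
- have -> : (`|j.+1 - j.+1| = 0)%N by lia.
  have -> : (`|j.+1 - j| = 1)%N by lia.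
  have -> : (`|j - j.+1| = 1)%N by lia.
  have -> : (`|j - j| = 0)%N by lia.
  have -> : (j == j.+1) = false by apply/eqP; lia.
  have -> : (j.+1 == j) = false by apply/eqP; lia.
  rewrite ?eqxx ?andbF ?andbT ?andbb.
  by case: j => [|j] /=; rewrite ?mulr1n !mulr0n !(exprS, exprD, addSn, addnS);
    field; rewrite N0 a2 a1.
Qed.

Lemma alt_charpoly_tridiag {R : realType} (a l : R) (n : nat) :
  `|a| < 1 -> (0 < n)%N ->
  alt_charpoly a n l =
    \det (tridiag_mx a (1 + a ^+ 2 - l / n%:R) n + const_mx (l / n%:R ^+ 2)).
Proof.
move=> a_lt1 n0.
have a2 : 1 - a ^+ 2 != 0.
  by rewrite subr_eq0 eq_sym sqr_norm_eq1 lt_eqF.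
have a1 : 1 - a != 0.
  by rewrite subr_eq0; apply: contraTneq a_lt1 => <-; rewrite normr1 ltxx.
rewrite -one_sub_K_mx_congr // !det_mulmx det_tr det_bidiag_mx.
by rewrite mul1r mulr1.
Qed.

(** * From Lucas sequences to the closed formula *)
(** The quantities [y], [z], [e] stand for [U_(n+1)], [U_n], [a ^+ n], and [V]
for the companion term of index [n - 1].  Running the recurrence backwards would
divide by [a ^+ 2], so only [a ^+ 2 * V] is expressed through [y] and [z]; the
formula contains [V] with a factor [a ^+ 4]. *)
Lemma closed_form_lucasU {F : fieldType} (a x y z e N d V : F) :
  N != 0 -> x - 2 * a != 0 -> x + 2 * a != 0 ->
  a ^+ 2 * V = x * y - x ^+ 2 * z + 2 * a ^+ 2 * z ->
  let l := N * (1 + a ^+ 2 - x) in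
  let D := x ^+ 2 - 4 * a ^+ 2 in
  let E := N * (1 - a) ^+ 2 - l in
  (x - 2 * a) ^+ 2 * d
    = (x - 2 * a) ^+ 2 * (y - a ^+ 2 * z)
      + l / N ^+ 2 * (N * (x - 2 * a) * (y - a ^+ 2 * z)
             - (a * (1 - a) * y + a ^+ 2 * (x - 1 - a) * z - a * e * (1 - a))
             - (1 - a) * (a * y - a ^+ 2 * z - a * e)) ->
  d = y - a ^+ 2 * z
  + l * (x * y - 2 * a ^+ 2 * z) / (N * D)
  - (N - 1) * a ^+ 2 * l * (2 * y - x * z) / (N ^+ 2 * D)
  + 2 * (N - 1) * a * l * (x * y - 2 * a ^+ 2 * z) / (N * D * E)
  - 2 * (N - 2) * a ^+ 3 * l * (2 * y - x * z) / (N * D * E)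
  - 2 * (N + 1) * a ^+ 2 * l * (2 * y - x * z) / (N * D * E)
  + 2 * a ^+ 4 * l * V / (D * E)
  + 2 * (a * e) * (1 - a) * l * x / (N * D * E)
  + 4 * (a * (a * e)) * (1 - a) * l / (N * D * E).
Proof.
move=> N0 k0 k1 hV l D E hd.
have ED : D = (x - 2 * a) * (x + 2 * a) by rewrite /D; ring.
have EE : E = N * (x - 2 * a) by rewrite /E /l; ring.
have -> : 2 * a ^+ 4 * l * V = 2 * a ^+ 2 * l * (a ^+ 2 * V) by ring.
rewrite hV {hV}; apply: (mulfI (expf_neq0 2 k0)); rewrite hd ED EE /l.
by field; rewrite N0 k0 k1.
Qed.

Lemma is_sqrt_sqr {R : realType} (s : R -> R[i]) (x : R) :
  is_sqrt s -> s x ^+ 2 = x%:C.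
Proof.
case=> s_ge0 s_lt0; case: (leP 0 x) => [x0|]; last exact: s_lt0.
by rewrite s_ge0 // -rmorphXn /= sqr_sqrtr.
Qed.

Lemma alt_charpoly_dn_formula {R : realType} (a : R) (s : R -> R[i]) (n : nat)
    (l : R) :
  `|a| < 1 -> is_sqrt s -> (0 < n)%N ->
  l <> n%:R * (1 - a) ^+ 2 -> l <> n%:R * (1 + a) ^+ 2 ->
  (alt_charpoly a n l)%:C = dn_formula s a n l.
Proof.
move=> a_lt1 s_sqrt n0 lm lp.
have N0 : n%:R != 0 :> R by rewrite pnatr_eq0 -lt0n.
set x := 1 + a ^+ 2 - l / n%:R.
have xE : 1 + a ^+ 2 - l / n%:R = x by [].
have lE : l = n%:R * (1 + a ^+ 2 - x) by rewrite /x; field.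
have k0 : x - 2 * a != 0.
  by apply/eqP => k0; apply: lm; rewrite lE (subr0_eq k0); ring.
have k1 : x + 2 * a != 0.
  apply/eqP => k1; apply: lp; rewrite lE.
  by have -> : x = - (2 * a) by [apply/eqP; rewrite -addr_eq0 k1]; ring.
have DE : Delta a (l / n%:R) = x ^+ 2 - 4 * a ^+ 2 by rewrite /Delta /x; ring.
have D0 : Delta a (l / n%:R) != 0.
  rewrite DE (_ : _ - _ = (x - 2 * a) * (x + 2 * a)); last by ring.
  by rewrite mulf_neq0.
set r := s (Delta a (l / n%:R)).
have r2 : r ^+ 2 = (Delta a (l / n%:R))%:C by exact: is_sqrt_sqr.
have r0 : r != 0 by rewrite -sqrf_eq0 r2 fmorph_eq0.
rewrite /dn_formula -/r.
have g1E : gamma1 s a (l / n%:R) = (x%:C + r) / 2.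
  by rewrite /gamma1 -/r; congr ((_%:C + _) / _); rewrite /x; ring.
have g2E : gamma2 s a (l / n%:R) = (x%:C - r) / 2.
  by rewrite /gamma2 -/r; congr ((_%:C - _) / _); rewrite /x; ring.
(* The value of [x] remains available as [xE]; making [x] opaque stops the ring
   morphisms below from being pushed into it. *)
clearbody x; rewrite g1E g2E {g1E g2E}; set g1 := (_ + r) / 2; set g2 := (_ - r) / 2.
have gD : g1 + g2 = x%:C by rewrite /g1 /g2; field.
have gB : g1 - g2 = r by rewrite /g1 /g2; field.
have gM : g1 * g2 = a%:C ^+ 2.
  rewrite (_ : g1 * g2 = (x%:C ^+ 2 - r ^+ 2) / 4); last by rewrite /g1 /g2; field.
  by rewrite r2 DE !(rmorph_nat, rmorphXn, rmorphN, rmorphM, rmorphD) /=; field.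
pose U k := lucasU x%:C (a%:C ^+ 2) k.
have powB k : (g1 ^+ k - g2 ^+ k) / r = U k.
  by rewrite -lucasU_binet gD gM gB mulrC mulKf.
have powD k : g1 ^+ k + g2 ^+ k = 2 * U k.+1 - x%:C * U k.
  by rewrite lucasU_companion gD gM.
have {n0} [m nE] : exists m, n = m.+1 by exists n.-1; lia.
have powD_pred : a%:C ^+ 2 * (g1 ^+ n.-1 + g2 ^+ n.-1)
    = x%:C * U n.+1 - x%:C ^+ 2 * U n + 2 * a%:C ^+ 2 * U n.
  by rewrite powD nE /= /U lucasUSS; ring.
have powDS : g1 ^+ n.+1 + g2 ^+ n.+1 = x%:C * U n.+1 - 2 * a%:C ^+ 2 * U n.
  by rewrite powD /U lucasUSS; ring.
have n0 : (0 < n)%N by rewrite nE.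
have dE := alt_charpoly_tridiag a l n a_lt1 n0; rewrite xE in dE.
have /(congr1 (real_complex R)) hd := det_tridiag_mxD_const a x (l / n%:R ^+ 2) n.
rewrite -dE /tridiag_det !(rmorph_nat, rmorphXn, fmorphV, rmorphN, rmorphM,
  rmorphD, rmorph1, map_lucasU) /= -/(U n) -/(U n.+1) in hd.
have NC0 : n%:R != 0 :> R[i] by rewrite pnatr_eq0 -lt0n.
have kC0 : x%:C - 2 * a%:C != 0.
  by rewrite -(rmorph_nat (real_complex R)) -rmorphM -rmorphB fmorph_eq0.
have kC1 : x%:C + 2 * a%:C != 0.
  by rewrite -(rmorph_nat (real_complex R)) -rmorphM -rmorphD fmorph_eq0.
have lC : l%:C = n%:R * (1 + a%:C ^+ 2 - x%:C).
  by rewrite [in LHS]lE !(rmorph_nat, rmorphXn, rmorphN, rmorphM, rmorphD, rmorph1).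
have DC : (Delta a (l / n%:R))%:C = x%:C ^+ 2 - 4 * a%:C ^+ 2.
  by rewrite DE !(rmorph_nat, rmorphXn, rmorphN, rmorphM, rmorphD).
rewrite (closed_form_lucasU a%:C x%:C (U n.+1) (U n) (a%:C ^+ n) n%:R
           (alt_charpoly a n l)%:C _ NC0 kC0 kC1 powD_pred); last first.
  by rewrite -lC hd !exprS; ring.
rewrite -lC -DC -[_ * (g1 ^+ n - g2 ^+ n) / r]mulrA !powB powDS (powD n) gD.
by rewrite [a%:C ^+ n.+2]exprS [a%:C ^+ n.+1]exprS.
Qed.

(** * Passage to the limit *)
Lemma alt_charpoly_continuous {R : realType} (a : R) (n : nat) :
  continuous (alt_charpoly a n).
Proof.
pose p : {poly R} := \det (1%:M - 'X *: map_mx polyC (K_mx a n)).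
suff -> : alt_charpoly a n = horner p by exact: continuous_horner.
apply/funext => l; rewrite /alt_charpoly -[RHS]/(horner_eval l p) -det_map_mx.
congr (\det _); apply/matrixP => i j; rewrite !mxE rmorphB rmorphM /=.
by rewrite /horner_eval hornerX hornerC hornerMn hornerC.
Qed.

Lemma cvg_real_complex {R : realType} {T : Type} (F : set_system T)
    (FF : Filter F) (f : T -> R) (y : R) :
  f t @[t --> F] --> y ->
  ((f t)%:C : R[i]^o) @[t --> F] --> (y%:C : R[i]^o).
Proof.
move=> /cvgrPdist_lt fy; apply/cvgrPdist_lt => e e0.
have [eps eE] : exists eps : R, e = eps%:C by apply/complex_realP/gtr0_real.
have eps0 : 0 < eps by rewrite -ltcR -eE.
near=> t; rewrite eE -rmorphB normc_def /= expr0n addr0 sqrtr_sqr ltcR.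
by near: t; exact: fy.
Unshelve. all: by end_near. Qed.

Theorem lemma2 (R : realType) (alpha : R) (s : R -> R[i]) (n : nat) (lambda : R) :
  `|alpha| < 1 -> is_sqrt s -> (0 < n)%N ->
  (lambda <> n%:R * (1 - alpha) ^+ 2 -> lambda <> n%:R * (1 + alpha) ^+ 2 ->
     (alt_charpoly alpha n lambda)%:C = dn_formula s alpha n lambda) /\
  (lambda = n%:R * (1 - alpha) ^+ 2 \/ lambda = n%:R * (1 + alpha) ^+ 2 ->
     (dn_formula s alpha n mu : R[i]^o) @[mu --> lambda^'] -->
       ((alt_charpoly alpha n lambda)%:C : R[i]^o)).
Proof.
move=> alpha_lt1 s_sqrt n_gt0; split; first exact: alt_charpoly_dn_formula.
move=> _.
(* For [alpha = 0] the two exceptional values coincide, so [b] may be [lambda]. *)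
have generic b : \forall mu \near lambda^', mu <> b.
  have [<-|bl] := eqVneq lambda b.
    by near=> mu; apply/eqP; near: mu; exact: nbhs_dnbhs_neq.
  apply: nbhs_dnbhs; near=> mu; apply/eqP; near: mu.
  exact: open_neq.
apply: cvg_trans; last first.
  apply: (@cvg_real_complex R R lambda^' _ (alt_charpoly alpha n)).
  exact/continuous_withinNx/alt_charpoly_continuous.
apply: near_eq_cvg; near=> mu.
apply: alt_charpoly_dn_formula => //.
- by near: mu; exact: generic.
- by near: mu; exact: generic.
Unshelve. all: by end_near. Qed.
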